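(* Let $f:X\to Y$ be a blow-up morphism between smooth Mori dream spaces over $\mathbb{C}$, let $T_1,\dots,T_m,S_1,\dots,S_n$ be a minimal set of homogeneous generators of the Cox ring $\mathcal{R}(X)$, where $S_1,\dots,S_n$ define the irreducible components of the exceptional divisor of $f$, and let $I(X)$ be the kernel of the natural surjection $\psi:\mathbb{C}[T,S]\to\mathcal{R}(X)$. Let $s_i\in\mathcal{R}(Y)$, the ideal $J=\ker(\phi)$ of the $K_T$-graded homomorphism $\phi:\mathbb{C}[T]\to\mathcal{R}(Y)$, $T_i\mapsto s_i$, and the ideal $J'\subset\mathbb{C}[T,S]$ be as defined in the context. Then $J'\subset I(X)$, and $J'=I(X)$ if $\dim J'=\dim I(X)$.
   Context: A Mori dream space here is a variety with finitely generated free class group and finitely generated Cox ring; the Cox ring of $X$ is $\mathcal{R}(X)=\bigoplus_{D\in K}H^0(X,\mathcal{O}_X(D))$ with $K\subset\mathrm{Div}(X)$ a subgroup mapped isomorphically onto $\mathrm{Cl}(X)$. $\mathbb{C}[T,S]$ is the polynomial ring in variables also denoted $T_1,\dots,T_m,S_1,\dots,S_n$, graded by $\mathrm{Cl}(X)=K_T\oplus K_S$, where $K_T=f^*\mathrm{Cl}(Y)$ and $K_S$ is the free abelian group generated by the degrees of $S_1,\dots,S_n$ (which form a basis of it). $\mathbb{C}[T]=\mathbb{C}[T_1,\dots,T_m]$ is graded by $K_T$ via the $K_T$-components of the degrees. $\mathbb{C}[T,S^{\pm1}]$ is the localization of $\mathbb{C}[T,S]$ at all the $S$ variables, and $\mathbb{C}[T,S^{\pm1}]_0$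 its degree zero part with respect to the $K_S$-grading. For each $i$ let $m_i(S)\in\mathbb{C}[S]$ be the unique monomial in the $S$ variables such that $T_i\cdot m_i(S)$ has $K_S$-degree zero. Let $\beta:\mathbb{C}[T]\to\mathbb{C}[T,S]$ and $\alpha:\mathbb{C}[T]\to\mathbb{C}[T,S^{\pm1}]_0$ be the homomorphisms with $T_i\mapsto T_i\cdot m_i(S)$ ($\alpha$ is an isomorphism). Since $\beta(T_i)$ has $K_S$-degree zero, there is $s_i\in\mathcal{R}(Y)$ with $\psi(\beta(T_i))=f^*(s_i)$, where $f^*:\mathcal{R}(Y)\to\mathcal{R}(X)$ is the (injective) pull-back homomorphism. $J'$ is the extension and contraction of $\alpha(J)$: the preimage in $\mathbb{C}[T,S]$, under the inclusion $\mathbb{C}[T,S]\subset\mathbb{C}[T,S^{\pm1}]$, of the ideal of $\mathbb{C}[T,S^{\pm1}]$ generated by $\alpha(J)$. The dimension of an ideal is the Krull dimension of its quotient ring. *)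

(* Defs.v *)
From HB Require Import structures.
From mathcomp Require Import all_boot all_order all_algebra.
From mathcomp Require Import boolp classical_sets reals complex freeg mpoly.

Set Implicit Arguments.
Unset Strict Implicit.
Unset Printing Implicit Defensive.

Import GRing.Theory.

Local Open Scope classical_set_scope.
Local Open Scope ring_scope.

Section Algebra.
Variables (k R : comNzRingType) (c : k -> R).
Implicit Types (A I S : set R).

Definition subalgebra A : Prop :=
  [/\ forall a, A (c a),
      forall x y, A x -> A y -> A (x + y) &
      forall x y, A x -> A y -> A (x * y)].

Definition alg_gen S : set R := smallest subalgebra S.

Definition fin_gen_alg A : Prop := exists s : seq R, A = alg_gen [set` s].

Definition ideal_in A I : Prop :=
  [/\ I `<=` A, I 0,
      forall x y, I x -> I y -> I (x + y) &
      forall a x, A a -> I x -> I (a * x)].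

Definition ideal_gen A S : set R := smallest (ideal_in A) S.

Definition prime_in A (P : set R) : Prop :=
  [/\ ideal_in A P, ~ P 1 &
      forall x y, A x -> A y -> P (x * y) -> P x \/ P y].

(* P 0 < ... < P n are primes of A containing the ideal I, that is, a chain
   of length n of primes of A / I. *)
Definition prime_chain A I n (P : nat -> set R) : Prop :=
  (forall i, (i <= n)%N -> prime_in A (P i) /\ I `<=` P i) /\
  (forall i, (i < n)%N -> P i `<` P i.+1).

(* The quotient ring A / I has Krull dimension n. *)
Definition krull_dim A I n : Prop :=
  (exists P, prime_chain A I n P) /\
  (forall l P, prime_chain A I l P -> (l <= n)%N).

End Algebra.

(* The group algebra F[G] of an abelian group G: finite sums of the elements
   << a *g d >> = a chi^d, with chi^d chi^e = chi^(d + e). *)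

Definition group_alg (F : comNzRingType) (G : zmodType) := {freeg G / F}.

Section GroupAlgebra.
Variables (F : comNzRingType) (G : zmodType).

HB.instance Definition _ := GRing.Zmodule.copy (group_alg F G) {freeg G / F}.

Implicit Types p q r : {freeg G / F}.

Definition gamul p q : {freeg G / F} :=
  \sum_(d <- dom p) \sum_(e <- dom q) << coeff d p * coeff e q *g d + e >>.

Let fgliftD (f : G -> {freeg G / F}) : {morph fglift f : p q / p + q}.
Proof.
move=> p q; have fB := lift_is_additive f.
have f0 : fglift f 0 = 0 by rewrite -(subrr 0) fB !subrr.
have fN r : fglift f (- r) = - fglift f r by rewrite -sub0r fB f0 sub0r.
by rewrite -{1}[q]opprK fB fN opprK.
Qed.

Let fglift0 (f : G -> {freeg G / F}) : fglift f 0 = 0.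
Proof. by rewrite -(subrr 0) lift_is_additive !subrr. Qed.

Let scaleU a b (d : G) : a *: << b *g d >> = << a * b *g d >> :> {freeg G / F}.
Proof. by apply/eqP/freeg_eqP => x; rewrite coeffZ !coeffU mulrA. Qed.

Let fgliftE (f : G -> {freeg G / F}) p :
  fglift f p = \sum_(d <- dom p) coeff d p *: f d.
Proof.
rewrite -{1}[p]freeg_sumE.
rewrite (big_morph (fglift f) (fgliftD f) (fglift0 f)).
by apply: eq_bigr => d _; rewrite liftU.
Qed.

Let gamulE p q :
  gamul p q =
  fglift (fun d => fglift (fun e => << d + e >> : {freeg G / F}) q) p.
Proof.
rewrite fgliftE; apply: eq_bigr => d _; rewrite fgliftE scaler_sumr.
by apply: eq_bigr => e _; rewrite scalerA scaleU mulr1.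
Qed.

Lemma gamulC : commutative gamul.
Proof.
move=> p q; rewrite /gamul exchange_big; apply: eq_bigr => e _.
by apply: eq_bigr => d _; rewrite mulrC addrC.
Qed.

Lemma gamulDl : left_distributive gamul +%R.
Proof. by move=> p q r; rewrite !gamulE fgliftD. Qed.

Let gamulDr : right_distributive gamul +%R.
Proof. by move=> p q r; rewrite !(gamulC p) gamulDl. Qed.

Let gamul0 p : gamul 0 p = 0.
Proof. by rewrite gamulE fglift0. Qed.

Lemma gamulUU a b (d e : G) :
  gamul << a *g d >> << b *g e >> = << a * b *g d + e >>.
Proof. by rewrite gamulE !liftU !scaleU mulr1. Qed.

Let ga_ind (Q : {freeg G / F} -> Prop) :
  Q 0 -> (forall p q, Q p -> Q q -> Q (p + q)) ->
  (forall a d, Q << a *g d >>) -> forall p, Q p.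
Proof.
by move=> Q0 QD QU p; rewrite -[p]freeg_sumE; elim/big_ind: _ => // d _.
Qed.

Lemma gamulA : associative gamul.
Proof.
move=> p q r; elim/ga_ind: p => [|p p' Hp Hp'|a d]; first by rewrite !gamul0.
  by rewrite !gamulDl Hp Hp'.
elim/ga_ind: q => [|q q' Hq Hq'|b e].
- by rewrite !(gamulC _ 0, gamul0).
- by rewrite !(gamulDl, gamulDr) Hq Hq'.
elim/ga_ind: r => [|r r' Hr Hr'|c' f].
- by rewrite !(gamulC _ 0, gamul0).
- by rewrite !gamulDr Hr Hr'.
by rewrite !gamulUU mulrA addrA.
Qed.

Lemma gamul1 : left_id << 0 >> gamul.
Proof.
elim/ga_ind => [|p q Hp Hq|a d]; first by rewrite gamulC gamul0.
  by rewrite gamulDr Hp Hq.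
by rewrite gamulUU mul1r add0r.
Qed.

Lemma ga_oner_neq0 : (<< 0 >> : {freeg G / F}) != 0.
Proof. by rewrite freegU_eq0 oner_eq0. Qed.

HB.instance Definition _ := GRing.Zmodule_isComNzRing.Build (group_alg F G)
  gamulA gamulC gamul1 gamulDl ga_oner_neq0.

End GroupAlgebra.

(* Varieties in Chevalley's language.  A variety (integral separated scheme of
   finite type over k) with function field F is encoded by the set of the local
   rings O_(X,x) of its scheme points x, as subrings of F.  A point is
   identified with its local ring; its generizations are the larger local
   rings. *)

Section LocalRings.
Variables (k : fieldType) (F : fieldType) (emb : {rmorphism k -> F}).
Implicit Types (A P N O V : set F).

(* The localisation at the prime P of A of an A-submodule N of F. *)
Definition localize N A P : set F :=
  [set z | exists x s, [/\ N x, A s, ~ P s & z = x / s]].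

Definition spec A : set (set F) :=
  [set O | exists2 P, prime_in A P & O = localize A A P].

Definition nonunits O : set F := [set x | O x /\ (x = 0 \/ ~ O x^-1)].

Definition local_ring O : Prop :=
  subalgebra emb O /\ ideal_in O (nonunits O).

Definition affine_algebra A : Prop :=
  fin_gen_alg emb A /\
  forall z, exists x y, [/\ A x, A y, y != 0 & z = x / y].

Definition dominates V O : Prop := O `<=` V /\ nonunits O `<=` nonunits V.

(* The last clause is separatedness: no local ring of F dominates the local
   rings of two distinct points. *)
Definition is_variety (pts : set (set F)) : Prop :=
  (exists n (A : 'I_n.+1 -> set F),
     (forall i, affine_algebra (A i)) /\ pts = \bigcup_i spec (A i)) /\
  (forall O1 O2 V, pts O1 -> pts O2 -> local_ring V ->
     dominates V O1 -> dominates V O2 -> O1 = O2).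

Definition regular_local O : Prop :=
  exists d (x : 'I_d -> F),
    krull_dim O [set 0] d /\ nonunits O = ideal_gen O (range x).

(* The order of x along a discrete valuation ring O; only meaningful for
   x != 0. *)
Definition ord O (x : F) : int :=
  xget 0 [set e | exists t u : F,
    [/\ nonunits O = ideal_gen O [set t], O u, O u^-1, u != 0 & x = u * t ^ e]].

End LocalRings.

Record variety (k : fieldType) := Variety {
  ffield : fieldType;
  emb : {rmorphism k -> ffield};
  pts : set (set ffield);
  variety_axiom : is_variety emb pts }.

Arguments ffield {k} v.
Arguments emb {k} v.
Arguments pts {k} v.

(* Divisors are finitely supported on arbitrary subsets of the function field;
   weil X singles out those supported on prime divisors of X. *)
Notation divisor X := {freeg (set (ffield X))}.

Section Varieties.
Variables (k : fieldType) (X : variety k).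
Local Notation F := (ffield X).
Implicit Types (D : divisor X) (P : set F) (K : set (divisor X)).

Definition smooth : Prop := forall O, pts X O -> regular_local O.

Definition affine_open (A : set F) : Prop :=
  affine_algebra (emb X) A /\ spec A `<=` pts X.

Definition prime_divisor P : Prop := pts X P /\ krull_dim P [set 0] 1.

Definition weil : set (divisor X) :=
  [set D | forall P, P \in dom D -> prime_divisor P].

Definition is_div (h : F) D : Prop :=
  weil D /\ forall P, prime_divisor P -> coeff P D = ord P h.

Definition lin_equiv D D' : Prop := exists2 h : F, h != 0 & is_div h (D - D').

Definition free_class_group : Prop :=
  exists r (B : 'I_r -> divisor X),
    (forall i, weil (B i)) /\
    forall D, weil D ->
      exists! a : {ffun 'I_r -> int}, lin_equiv D (\sum_i B i *~ a i).

(* H^0(X, O_X(D)) *)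
Definition sections D : set F :=
  [set s | s = 0 \/ forall P, prime_divisor P -> 0 <= ord P s + coeff P D].

(* K is a subgroup of Div(X) mapped isomorphically onto Cl(X). *)
Definition represents_class_group K : Prop :=
  [/\ K `<=` weil, K 0, forall D D', K D -> K D' -> K (D - D') &
      forall D, weil D -> exists! D', K D' /\ lin_equiv D D'].

Definition cox_ambient := group_alg F (divisor X).

(* The direct sum of the H^0(X, O_X(D)) for D in K, as a subring of the group
   algebra F[Div(X)]: a section s of O_X(D) is the element s chi^D. *)
Definition cox K : set cox_ambient :=
  [set s | forall D : divisor X,
     coeff D s != 0 -> K D /\ sections D (coeff D s)].

Definition cox_const (a : k) : cox_ambient := << emb X a *g 0 >>.

Definition mori_dream_space : Prop :=
  free_class_group /\
  exists2 K, represents_class_group K & fin_gen_alg cox_const (cox K).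

Definition homogeneous K D (x : cox_ambient) : Prop :=
  K D /\ exists s, [/\ sections D s, s != 0 & x = << s *g D >>].

(* The prime divisor P is the divisor div(s) + D of the section x = s chi^D. *)
Definition defines_divisor D (x : cox_ambient) P : Prop :=
  exists s, [/\ s != 0, x = << s *g D >> & is_div s (<< P >> - D)].

(* (x i) is a minimal set of homogeneous generators, with degrees d i. *)
Definition minimal_generators K (N : nat)
    (x : 'I_N -> cox_ambient) (d : 'I_N -> divisor X) : Prop :=
  [/\ forall i, homogeneous K (d i) (x i),
      alg_gen cox_const (range x) = cox K &
      forall i, alg_gen cox_const (x @` [set j | j != i]) <> cox K].

End Varieties.

Arguments smooth {k} X.
Arguments mori_dream_space {k} X.
Arguments cox_const {k} X.

(* A birational morphism X -> Y, given by its comorphism fs : F(Y) -> F(X). *)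

Section BlowUp.
Variables (k : fieldType) (X Y : variety k).
Variable fs : {rmorphism ffield Y -> ffield X}.

(* The morphism sends the point O of X to the point y of Y. *)
Definition maps_to (O : set (ffield X)) (y : set (ffield Y)) : Prop :=
  y `<=` fs @^-1` O /\ nonunits y `<=` fs @^-1` nonunits O.

(* I y is the stalk at y of a nonzero coherent sheaf of ideals on Y. *)
Definition coherent_ideal (I : set (ffield Y) -> set (ffield Y)) : Prop :=
  forall y, pts Y y ->
    exists A a, [/\ affine_open A, spec A y, ideal_in A a,
      exists2 x, a x & x != 0 &
      forall P, prime_in A P -> I (localize A A P) = localize a A P].

(* The points of the blow-up of I: Proj of the Rees algebra of I y over O_y is
   covered by the spectra of the algebras O_y[I y / a], with a in I y
   nonzero. *)
Definition blow_up_points (I : set (ffield Y) -> set (ffield Y)) :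
    set (set (ffield Y)) :=
  [set O | exists y a, [/\ pts Y y, I y a, a != 0 &
     spec (alg_gen (emb Y) (y `|` [set b / a | b in I y])) O]].

(* fs is the comorphism of an isomorphism of X with the blow-up of Y along a
   closed subscheme, composed with the projection to Y. *)
Definition is_blow_up : Prop :=
  [/\ bijective fs,
      forall a, fs (emb Y a) = emb X a &
      exists2 I, coherent_ideal I &
        forall O, pts X O <-> blow_up_points I (fs @^-1` O)].

(* A prime divisor of X is exceptional if it is contracted: its image is a
   point of codimension at least two. *)
Definition exceptional (E : set (ffield X)) : Prop :=
  prime_divisor E /\
  exists2 y, pts Y y /\ maps_to E y & ~ prime_divisor y.

Definition local_equation (D : divisor Y) y (h : ffield Y) : Prop :=
  h != 0 /\ forall P, prime_divisor P -> y `<=` P -> coeff P D = ord P h.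

(* D' is the pull-back of D, a Cartier divisor as Y is smooth. *)
Definition is_pullback (D : divisor Y) (D' : divisor X) : Prop :=
  [/\ weil D, weil D' &
      forall E, prime_divisor E -> exists y h,
        [/\ pts Y y, maps_to E y, local_equation D y h &
            coeff E D' = ord E (fs h)]].

(* The class of D lies in K_T = f^* Cl(Y). *)
Definition in_pullback_class (D : divisor X) : Prop :=
  exists D1 D1', is_pullback D1 D1' /\ lin_equiv D D1'.

(* The pull-back homomorphism of Cox rings.  For D in KY the divisor f^* D is
   only linearly equivalent to an element E = f^* D + div(h) of KX, and f^* on
   H^0(Y, O(D)) is s |-> f^* s in H^0(X, O(f^* D)) followed by the isomorphism
   s |-> s / h onto H^0(X, O(E)). *)
Definition cox_pullback KY KX (g : cox_ambient Y -> cox_ambient X) : Prop :=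
  [/\ forall x, cox KY x -> cox KX (g x),
      forall x y, cox KY x -> cox KY y -> g (x + y) = g x + g y,
      forall x y, cox KY x -> cox KY y -> g (x * y) = g x * g y,
      forall a, g (cox_const Y a) = cox_const X a &
      forall D : divisor Y, KY D -> exists h D' (E : divisor X),
        [/\ h != 0, is_pullback D D', KX E, is_div h (E - D') &
            forall s, sections D s -> g << s *g D >> = << fs s / h *g E >>]].

End BlowUp.

(* C[T, S] is {mpoly k[m + n]}: T_i is the variable lshift n i and S_j is the
   variable rshift m j. *)

Section Polynomials.
Variables (k : fieldType) (m n : nat).

Definition monomS (e : 'I_n -> nat) : {mpoly k[m + n]} :=
  \prod_(j < n) 'X_(rshift m j) ^+ e j.

(* beta : C[T] -> C[T, S], T_i |-> T_i m_i(S), where mu i is the exponent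
   vector of m_i(S). *)
Definition beta (mu : 'I_m -> 'I_n -> nat) (p : {mpoly k[m]}) :
    {mpoly k[m + n]} :=
  p \mPo [tuple 'X_(lshift n i) * monomS (mu i) | i < m].

(* C[T, S^{+-1}], inside the fraction field of C[T, S]. *)
Definition laurent : set {fraction {mpoly k[m + n]}} :=
  [set z | exists p e, z = tofrac p / tofrac (monomS e)].

Definition alpha mu (p : {mpoly k[m]}) : {fraction {mpoly k[m + n]}} :=
  tofrac (beta mu p).

(* J' : the contraction to C[T, S] of the extension of alpha(J). *)
Definition ext_contr mu (J : set {mpoly k[m]}) : set {mpoly k[m + n]} :=
  [set p | ideal_gen laurent (alpha mu @` J) (tofrac p)].

End Polynomials.

Definition same_dim (R : comNzRingType) (I J : set R) : Prop :=
  exists d, krull_dim setT I d /\ krull_dim setT J d.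

(* The homomorphism from a polynomial ring to (the ambient ring of) a Cox ring
   sending the i-th variable to x i, and its kernel. *)
Definition cox_eval (k : fieldType) (X : variety k) N
    (x : 'I_N -> cox_ambient X) (p : {mpoly k[N]}) : cox_ambient X :=
  mmap (cox_const X) x p.

Definition cox_kernel (k : fieldType) (X : variety k) N
    (x : 'I_N -> cox_ambient X) : set {mpoly k[N]} :=
  [set p | cox_eval x p = 0].

(* Main.v *)
From HB Require Import structures.
Require Import Defs.
From mathcomp Require Import all_boot all_order all_algebra.
From mathcomp Require Import boolp classical_sets reals complex freeg mpoly.

(** Why the theorem holds.

    Inclusion.  Both psi o beta and f^* o phi are ring homomorphisms on C[T]
    which agree on constants and on the variables, so they are equal
    [cox_eval_beta] and psi kills beta(J).  An element p of J' satisfies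
    m p = sum_i q_i beta(j_i) in C[T, S], with j_i in J and m a monomial in the
    S variables; hence psi(m) psi(p) = 0.  Since psi(S_j) is a nonzero element
    of the function field times a group element, it is a unit of the group
    algebra, and psi(p) = 0 [ext_contr_sub_kernel].

    The comparison of f^* o phi with psi o beta uses that R(Y) is closed under
    sums and products.  As H^0(Y, O(D)) is cut out by orders along prime
    divisors, this says that the local ring of a prime divisor is a discrete
    valuation ring, which is derived from its being regular of dimension 1:
    the elements divisible by all powers of a generator t of the maximal ideal
    form a prime strictly inside (t), so in dimension 1 they vanish
    [infinitely_divisible].

    Equality.  The ideal J' is prime: T_i |-> T_i m_i(S), S_j |-> S_j is an
    automorphism of C[T, S^{+-1}], and it maps the ideal generated by J to the
    one generated by alpha(J).  Hence J' is the kernel of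
    T_i |-> s_i m_i(S)^{-1}, S_j |-> S_j, a homomorphism from C[T, S] to the
    group algebra of Z^n over the group algebra of Div(Y) [twisted_eval,
    ext_contr_eq_kernel].  Group algebras of free abelian groups over domains
    are domains [ga_integral], so the kernel is prime.  If J' were strictly
    smaller than I(X), it could be put below a longest chain of primes
    containing I(X), and dim J' would exceed dim I(X)
    [prime_eq_of_same_dim]. *)

Set Implicit Arguments.
Unset Strict Implicit.
Unset Printing Implicit Defensive.

Import Order.TTheory GRing.Theory Num.Theory.

Local Open Scope classical_set_scope.
Local Open Scope ring_scope.

(** * Group algebras of free abelian groups *)

Section GroupAlgebra.
Variables (R : comNzRingType) (G : zmodType).
Implicit Types p q : group_alg R G.

Lemma ga_mulUU a b (d e : G) :
  (<< a *g d >> : group_alg R G) * << b *g e >> = << a * b *g d + e >>.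
Proof. exact: gamulUU. Qed.

Lemma ga_coeffM p q c :
  coeff c (p * q) =
  \sum_(d <- dom p) \sum_(e <- dom q)
     coeff d p * coeff e q * (d + e == c)%:R.
Proof.
rewrite [p * q]/(gamul p q) /gamul raddf_sum; apply: eq_bigr => d _.
by rewrite raddf_sum; apply: eq_bigr => e _; rewrite /= coeffU.
Qed.

End GroupAlgebra.

Lemma ga_prodU (R : comNzRingType) (G : zmodType) (I : finType)
    (a : I -> R) (d : I -> G) (e : I -> nat) :
  \prod_i (<< a i *g d i >> : group_alg R G) ^+ e i =
  << \prod_i a i ^+ e i *g \sum_i d i *+ e i >>.
Proof.
have ga_expU b c l :
  (<< b *g c >> : group_alg R G) ^+ l = << b ^+ l *g c *+ l >>.
  elim: l => [|l IHl]; first by rewrite !expr0 mulr0n.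
  by rewrite !exprS IHl ga_mulUU mulrS.
pose Q := fun (x : group_alg R G) b c => x = << b *g c >>.
apply: (big_rec3 Q) => // i x b c _ ->.
by rewrite /Q ga_expU ga_mulUU.
Qed.

Lemma ga_unit_lreg (R : comNzRingType) (G : zmodType) (a b : R) (d : G) :
  b * a = 1 -> GRing.lreg (<< a *g d >> : group_alg R G).
Proof.
move=> ba1; pose x : group_alg R G := << b *g - d >>.
apply: (can_inj (g := fun y => x * y)) => y.
by rewrite /x mulrA ga_mulUU ba1 addNr mul1r.
Qed.

(** Stated for a bare function, so that the constants of a Cox ring are
    literally an instance. *)
Definition ga_const (S R : comNzRingType) (G : zmodType) (f : S -> R) (a : S) :
  group_alg R G := << f a *g 0 >>.

Section GroupAlgebraConst.
Variables (S R : comNzRingType) (G : zmodType) (f : {rmorphism S -> R}).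

Lemma ga_const_is_zmod_morphism : zmod_morphism (@ga_const S R G f).
Proof. by move=> a b; rewrite /ga_const rmorphB /= freegUB. Qed.

Lemma ga_const_is_monoid_morphism : monoid_morphism (@ga_const S R G f).
Proof.
split=> [|a b]; rewrite /ga_const; first by rewrite rmorph1.
by rewrite ga_mulUU addr0 rmorphM.
Qed.

HB.instance Definition _ := GRing.isZmodMorphism.Build S (group_alg R G)
  (@ga_const S R G f) ga_const_is_zmod_morphism.
HB.instance Definition _ := GRing.isMonoidMorphism.Build S (group_alg R G)
  (@ga_const S R G f) ga_const_is_monoid_morphism.

End GroupAlgebraConst.

Lemma exists_max_seq (T : eqType) (w : T -> int) (s : seq T) :
  s != [::] -> exists2 a, a \in s & {in s, forall d, w d <= w a}.
Proof.
elim: s => // a [|b s] IHs _.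
  by exists a; [rewrite mem_head|move=> d; rewrite inE => /eqP->].
have [//|c cs cmax] := IHs; have [le_ac|lt_ca] := leP (w a) (w c).
  exists c; first by rewrite inE cs orbT.
  by move=> d; rewrite inE => /predU1P[->|/cmax].
exists a; first exact: mem_head.
move=> d; rewrite inE => /predU1P[->//|/cmax le_dc].
exact: le_trans le_dc (ltW lt_ca).
Qed.

Lemma exists_nonroot (p : {poly int}) : p != 0 -> exists t, ~~ root p t.
Proof.
move=> p_neq0; pose s : seq int := [seq i%:Z | i <- iota 0 (size p)].
have [/(max_poly_roots p_neq0)|/allPn[t _ ?]] := boolP (all (root p) s);
  last by exists t.
rewrite map_inj_uniq => [/(_ (iota_uniq _ _))|i j []//].
by rewrite size_map size_iota ltnn.
Qed.

(** A degree is read as the integer polynomial whose coefficients are its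
    coordinates; finitely many distinct polynomials take distinct values at
    any integer that is not a root of the product of their differences. *)
Lemma exists_separating_weight (T : choiceType) (s : seq {freeg T / int}) :
  exists w : {freeg T / int} -> int,
    {morph w : d e / d + e} /\ {in s &, injective w}.
Proof.
pose r := flatten [seq dom d | d <- s].
pose P (d : {freeg T / int}) : {poly int} :=
  \sum_(i < size r) (coeff (tnth (in_tuple r) i) d)%:P * 'X^i.
have PD : {morph P : d e / d + e}.
  move=> d e; rewrite -big_split; apply: eq_bigr => i _ /=.
  by rewrite coeffD polyCD mulrDl.
have P_inj : {in s &, injective P}.
  move=> d e ds es eq_P; apply/eqP/freeg_eqP => x.
  have [xr|xr] := boolP (x \in r); last first.
    have out c : c \in s -> coeff x c = 0.
      move=> cs; apply: coeff_outdom; apply: contra xr => xc.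
      by apply/flatten_mapP; exists c.
    by rewrite !out.
  have [i ->] : exists i, x = tnth (in_tuple r) i by apply/tnthP.
  have PE c : (P c)`_i = coeff (tnth (in_tuple r) i) c.
    rewrite coef_sum (bigD1 i) //= coefCM coefXn eqxx mulr1 big1 ?addr0 //.
    move=> j; rewrite coefCM coefXn -val_eqE eq_sym => /negPf/= ->.
    by rewrite mulr0.
  by rewrite -!PE eq_P.
(* A point where no difference of two of the polynomials vanishes. *)
pose Q : {poly int} := \prod_(d <- s) \prod_(e <- s | P e != P d) (P e - P d).
have [|t] := @exists_nonroot Q.
  rewrite prodf_seq_neq0; apply/allP => d _ /=.
  rewrite prodf_seq_neq0; apply/allP => e _ /=.
  by apply/implyP; rewrite subr_eq0.
rewrite /root !horner_prod; rewrite prodf_seq_neq0 => /allP Qt.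
exists (fun d => (P d).[t]); split=> [d e|d e ds es eq_de].
  by rewrite PD hornerD.
apply: P_inj => //; apply/eqP; apply: contraT => neq_de.
have := Qt e es; rewrite /= horner_prod prodf_seq_neq0 => /allP/(_ d ds).
by rewrite neq_de /= hornerD hornerN eq_de subrr eqxx.
Qed.

(** Choose a weight separating the degrees in the supports of both factors.  The
    product of the two terms of largest weight cannot be cancelled, because
    their total degree arises from no other pair of terms. *)
Lemma ga_integral (R : comNzRingType) (T : choiceType) :
  GRing.integral_domain_axiom R ->
  GRing.integral_domain_axiom (group_alg R {freeg T / int}).
Proof.
move=> intR p q pq0; apply: contraT; rewrite negb_or -!dom_eq0 => /andP[p0 q0].
have [w [wD w_inj]] := exists_separating_weight (dom p ++ dom q).
have [a ap a_max] := exists_max_seq w p0.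
have [b bq b_max] := exists_max_seq w q0.
have : coeff (a + b) (p * q) = coeff a p * coeff b q.
  rewrite ga_coeffM (bigD1_seq a) ?uniq_dom //=.
  rewrite [X in X + _](bigD1_seq b) ?uniq_dom //= eqxx mulr1.
  rewrite [X in _ + X + _]big1 => [|e /negPf neq_eb]; last first.
    by rewrite (inj_eq (addrI a)) neq_eb mulr0.
  rewrite addr0 big_seq_cond big1 ?addr0 // => d /andP[dp neq_da].
  rewrite big_seq big1 // => e eq_in.
  have [/(congr1 w)|_] := eqVneq (d + e) (a + b); last by rewrite mulr0.
  rewrite !wD => eq_w; case/eqP: neq_da.
  apply: w_inj; rewrite ?mem_cat ?dp ?ap //; apply/eqP.
  rewrite eq_le a_max //= -(lerD2r (w e)) eq_w lerD2l; exact: b_max.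
rewrite pq0 coeff0 => /esym/intR.
by move: ap bq; rewrite !mem_dom => /negPf-> /negPf->.
Qed.

(** * One-dimensional regular local rings *)

Lemma krull_dim_unique (R : comNzRingType) (A I : set R) d e :
  krull_dim A I d -> krull_dim A I e -> d = e.
Proof.
move=> [[P chP] maxd] [[Q chQ] maxe].
by apply/eqP; rewrite eqn_leq (maxe _ _ chP) (maxd _ _ chQ).
Qed.

Lemma alg_gen_subalgebra (k R : comNzRingType) (c : k -> R) S :
  subalgebra c (alg_gen c S).
Proof.
split=> [a B [[Bc _ _] _]|x y xS yS B BS|x y xS yS B BS]; first exact: Bc.
  by case: (BS) => -[_ BD _] _; apply: BD; [apply: xS|apply: yS].
by case: (BS) => -[_ _ BM] _; apply: BM; [apply: xS|apply: yS].
Qed.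

Section LocalRingTheory.
Variables (k F : fieldType) (emb : {rmorphism k -> F}).
Implicit Types (A P O : set F).

Lemma subalgebra0 A : subalgebra emb A -> A 0.
Proof. by move=> [Ac _ _]; rewrite -(rmorph0 emb). Qed.

Lemma subalgebra1 A : subalgebra emb A -> A 1.
Proof. by move=> [Ac _ _]; rewrite -(rmorph1 emb). Qed.

Lemma subalgebraX A x n : subalgebra emb A -> A x -> A (x ^+ n).
Proof.
move=> hA Ax; elim: n => [|n IHn]; first exact: subalgebra1.
by rewrite exprS; case: hA => _ _; apply.
Qed.

Lemma localize_subalgebra A P :
  subalgebra emb A -> prime_in A P -> subalgebra emb (localize A A P).
Proof.
move=> hA [[_ P0 _ _] P1 Pprime]; have [Ac AD AM] := hA.
have nP s : ~ P s -> s != 0 by move=> Ps; apply/eqP => s0; rewrite s0 in Ps.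
have nPM s t : A s -> A t -> ~ P s -> ~ P t -> ~ P (s * t).
  by move=> As At Ps Pt /(Pprime _ _ As At)[].
split=> [a|_ _ [x [s [Ax As Ps ->]]] [y [t [Ay At Pt ->]]]|
         _ _ [x [s [Ax As Ps ->]]] [y [t [Ay At Pt ->]]]].
- by exists (emb a), 1; split; rewrite ?divr1 //; exact: subalgebra1.
- exists (x * t + y * s), (s * t); split; [|exact: AM|exact: nPM|].
    by apply: AD; apply: AM.
  by rewrite addf_div ?nP.
- exists (x * y), (s * t); split; [exact: AM|exact: AM|exact: nPM|].
  by rewrite mulf_div.
Qed.

Definition units O : set F := [set u | [/\ O u, O u^-1 & u != 0]].

Lemma not_nonunits O y : O y -> ~ nonunits O y -> units O y.
Proof.
move=> Oy ny; split=> //.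
  by apply: contrapT => nOy; apply: ny; split; [|right].
by apply/eqP => y0; apply: ny; split; [|left].
Qed.

Section PrincipalMaximalIdeal.
Variables (O : set F) (t : F).
Hypothesis (hO : subalgebra emb O).

Lemma unitsM u v : units O u -> units O v -> units O (u * v).
Proof.
case: hO => _ _ OM [Ou Ou' u0] [Ov Ov' v0].
by split; [exact: OM|rewrite invfM; exact: OM|exact: mulf_neq0].
Qed.

Lemma unitsV u : units O u -> units O u^-1.
Proof. by move=> [Ou Ou' u0]; split; rewrite ?invrK ?invr_eq0. Qed.

Lemma unitsXz u (e : int) : units O u -> units O (u ^ e).
Proof.
have unitsX n v : units O v -> units O (v ^+ n).
  move=> [Ov Ov' v0]; split; rewrite ?expf_neq0 //; first exact: subalgebraX.
  by rewrite -exprVn; exact: subalgebraX.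
by case: e => n uu; [apply: unitsX|apply/unitsV/unitsX].
Qed.

Lemma mul_unitsE u z : units O u -> O (u * z) <-> O z.
Proof.
case: hO => _ _ OM [Ou Ou' u0]; split=> [Ouz|]; last exact: OM.
by rewrite -(mulKf u0 z); exact: OM.
Qed.

Hypothesis t_gen : nonunits O = ideal_gen O [set t].

Lemma generator_in : O t.
Proof.
apply: contrapT => nOt.
have : nonunits O 1 by rewrite t_gen => B [[BO _ _ _] /(_ t erefl)/BO].
case=> O1 [/eqP|]; first by rewrite oner_eq0.
by rewrite invr1.
Qed.

Lemma nonunitsE y : nonunits O y <-> exists2 a, O a & y = a * t.
Proof.
have [_ OD OM] := hO; have Ot := generator_in.
rewrite t_gen; split=> [yt|[a Oa -> B [[BO B0 BD BM] Bt]]]; last first.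
  by apply: BM => //; apply: Bt.
apply: (yt [set y | exists2 a, O a & y = a * t]); split; last first.
  by move=> _ ->; exists 1; [exact: subalgebra1|rewrite mul1r].
split=> [_ [a Oa ->]||_ _ [a Oa ->] [b Ob ->]|b _ Ob [a Oa ->]].
- exact: OM.
- by exists 0; [exact: subalgebra0|rewrite mul0r].
- by exists (a + b); [exact: OD|rewrite mulrDl].
- by exists (b * a); [exact: OM|rewrite mulrA].
Qed.

Hypothesis (t0 : t != 0).

Lemma generator_inv : ~ O t^-1.
Proof.
have [_ [/eqP|//]] : nonunits O t; last by rewrite (negPf t0).
by apply/nonunitsE; exists 1; [exact: subalgebra1|rewrite mul1r].
Qed.

Lemma generator_Xz (e : int) : O (t ^ e) <-> 0 <= e.
Proof.
have [_ _ OM] := hO; case: e => n; split=> //.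
  by move=> _; apply: subalgebraX => //; exact: generator_in.
move=> Otn; case: generator_inv.
have -> : t^-1 = t ^+ n * t ^- n.+1.
  by rewrite exprS invfM mulrCA mulfV ?mulr1 ?expf_neq0.
by apply: OM => //; apply: subalgebraX => //; exact: generator_in.
Qed.

(** The exponent is one less than the first power of t that fails to divide x;
    the quotient is then outside the maximal ideal. *)
Lemma finite_order x : O x -> (exists n, ~ O (x / t ^+ n)) ->
  exists n u, units O u /\ x = u * t ^+ n.
Proof.
move=> Ox exn.
have exb : exists n, `[< ~ O (x / t ^+ n) >].
  by case: exn => n xn; exists n; apply/asboolP.
case: (ex_minnP exb) => -[|n] /asboolP nO nmin.
  by case: nO; rewrite expr0 divr1.
have Oxn : O (x / t ^+ n).
  by apply: contrapT => /asboolP/nmin; rewrite ltnn.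
exists n, (x / t ^+ n); split; last by rewrite divfK // expf_neq0.
apply: not_nonunits => // /nonunitsE[a Oa eq_a]; apply: nO.
by rewrite exprS invfM mulrCA eq_a mulrCA mulVf ?mulr1.
Qed.

(** The elements divisible by every power of t form a prime ideal, since a
    product of two elements u t^i and v t^j of finite order has finite order
    i + j.  This prime does not contain t, so a nonzero element in it would
    give a chain of primes of length 2. *)
Lemma infinitely_divisible x :
  krull_dim O [set 0] 1 -> (forall n, O (x / t ^+ n)) -> x = 0.
Proof.
move=> [_ dim1] xO; apply: contrapT => /eqP x0.
have [_ OD OM] := hO; have O0 := subalgebra0 hO; have O1 := subalgebra1 hO.
pose Q : set F := [set y | forall n, O (y / t ^+ n)].
have QO : Q `<=` O by move=> y /(_ 0%N); rewrite expr0 divr1.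
suff: prime_chain O [set 0] 2
  (fun i => match i with 0 => [set 0] | 1 => Q | _ => nonunits O end).
  by move/dim1.
have n1 : ~ nonunits O 1.
  by case=> _ [/eqP|]; rewrite ?oner_eq0 // invr1.
have Q0 : Q 0 by move=> n; rewrite mul0r.
have prime0 : prime_in O [set 0].
  split=> [||a b _ _ /eqP]; last first.
  - by rewrite mulf_eq0 => /orP[]/eqP; [left|right].
  - by move/eqP; rewrite oner_eq0.
  - split=> [_ ->//|//|_ _ -> ->|a _ _ ->]; first by rewrite addr0.
    by rewrite mulr0.
have primeQ : prime_in O Q.
  split=> [||a b Oa Ob Qab].
  - split=> // [a b Qa Qb n|a b Oa Qb n]; first by rewrite mulrDl; exact: OD.
    by rewrite -mulrA; exact: OM.
  - by move/(_ 1%N); rewrite expr1 mul1r; exact: generator_inv.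
  - apply: contrapT => /not_orP[/existsNP/(finite_order Oa)[i [u [uu eq_a]]]].
    move=> /existsNP/(finite_order Ob)[j [v [uv eq_b]]].
    apply: generator_inv; apply/(mul_unitsE _ (unitsM uu uv)).
    suff -> : u * v / t = a * b / t ^+ (i + j).+1 by exact: Qab.
    by rewrite eq_a eq_b mulrACA -exprD exprSr invfM mulrA mulfK ?expf_neq0.
have primeM : prime_in O (nonunits O).
  split=> [|//|a b Oa Ob /nonunitsE ab].
    split=> [a []//||a b|a b Oa]; first by split; [|left].
      move=> /nonunitsE[c Oc ->] /nonunitsE[e Oe ->]; apply/nonunitsE.
      by exists (c + e); [exact: OD|rewrite mulrDl].
    move=> /nonunitsE[c Oc ->]; apply/nonunitsE.
    by exists (a * c); [exact: OM|rewrite mulrA].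
  apply: contrapT => /not_orP[/(not_nonunits Oa) ua /(not_nonunits Ob) ub].
  have [c Oc eq_c] := ab; apply: generator_inv.
  have [_ _] := unitsM ua ub; rewrite eq_c mulf_eq0 => /norP[c0 _].
  have [_ + _] := unitsM ua ub; rewrite eq_c invfM => /(OM c _ Oc).
  by rewrite mulVKf.
have Ot : nonunits O t.
  by apply/nonunitsE; exists 1; rewrite ?mul1r.
have QM : Q `<=` nonunits O.
  move=> y /(_ 1%N) Oy; apply/nonunitsE; exists (y / t ^+ 1) => //.
  by rewrite expr1 divfK.
have nQt : ~ Q t.
  by move/(_ 2%N); rewrite expr2 invfM mulVKf //; exact: generator_inv.
have M0 : nonunits O 0 by split; [|left].
split=> [[|[|[|//]]] _|[|[|//]] _]; split=> //; rewrite ?sub1set ?inE //.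
- by move/(_ x xO)/eqP; rewrite (negPf x0).
- by move/(_ t Ot).
Qed.

Lemma valuation_exists x : krull_dim O [set 0] 1 ->
  (forall z, exists a b, [/\ O a, O b, b != 0 & z = a / b]) ->
  x != 0 -> exists (e : int) u, units O u /\ x = u * t ^ e.
Proof.
move=> dim1 fracO x0; have [a [b [Oa Ob b0 eq_x]]] := fracO x.
have val y : O y -> y != 0 -> exists n u, units O u /\ y = u * t ^+ n.
  move=> Oy y0; apply: finite_order => //; apply: contrapT => /forallNP yO.
  case/eqP: y0; apply: infinitely_divisible => // n.
  exact: contrapT (yO n).
have a0 : a != 0 by apply: contraNneq x0 => a0; rewrite eq_x a0 mul0r.
have [i [u [uu eq_a]]] := val a Oa a0.
have [j [v [uv eq_b]]] := val b Ob b0.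
exists (i%:Z - j%:Z), (u / v); split; first exact: unitsM uu (unitsV uv).
by rewrite eq_x eq_a eq_b expfzDr // -invr_expz invfM mulrACA.
Qed.

End PrincipalMaximalIdeal.

Lemma regular_dim1_generator O : regular_local O -> krull_dim O [set 0] 1 ->
  exists t, nonunits O = ideal_gen O [set t].
Proof.
move=> [d [x [dimd ->]]] dim1; have eq_d := krull_dim_unique dimd dim1.
rewrite {d}eq_d in x dimd *; exists (x ord0); congr ideal_gen.
apply/seteqP; split=> [_ [i _ <-]|_ ->]; last by exists ord0.
by rewrite (ord1 i).
Qed.

(** If t = 0, the ring is a field and has no chain of primes of length 1. *)
Lemma dim1_nonzero_generator O t : subalgebra emb O ->
  krull_dim O [set 0] 1 -> nonunits O = ideal_gen O [set t] -> t != 0.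
Proof.
move=> hO [[P [primeP ltP]] _] t_gen; apply/eqP => t0.
have [[[P0O P00 _ _] _ _] _] := primeP 0%N isT.
have [[[P1O _ _ P1M] P11 _] _] := primeP 1%N isT.
have [_] := ltP 0%N isT; apply => y P1y.
have [->//|/eqP y0] := pselect (y = 0).
have [_ Oy' _] : units O y.
  apply: not_nonunits; first exact: P1O.
  move/(nonunitsE hO t_gen) => [a _]; rewrite t0 mulr0 => /eqP.
  by rewrite (negPf y0).
by case: P11; rewrite -(mulVf y0); apply: P1M.
Qed.

(** The order is defined by a choice of generator and exponent that need not be
    the given t; two generators differ by a unit, which does not affect
    membership in O.  In this form the conditions defining sections make sense
    for 0 as well, and are visibly stable under sums and products. *)
Lemma ord_sectionE O t x c : subalgebra emb O ->
  nonunits O = ideal_gen O [set t] -> krull_dim O [set 0] 1 ->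
  (forall z, exists a b, [/\ O a, O b, b != 0 & z = a / b]) ->
  t != 0 -> x != 0 ->
  O (x * t ^ c) <-> 0 <= ord O x + c.
Proof.
move=> hO t_gen dim1 fracO t0 x0.
pose E := [set e | exists t' u : F, [/\ nonunits O = ideal_gen O [set t'],
    O u, O u^-1, u != 0 & x = u * t' ^ e]].
have [e [u [[Ou Ou' u0] eq_x]]] := valuation_exists hO t_gen t0 dim1 fracO x0.
have Ee : E e by exists t, u.
have [t' [u' [t'_gen Ou'1 Ou'2 u'0]]] : E (ord O x) by apply: xgetPex; exists e.
move: (ord O x) => e' eq_x'.
have [a Oa eq_t'] : exists2 a, O a & t' = a * t.
  apply/(nonunitsE hO t_gen)/(nonunitsE hO t'_gen).
  by exists 1; [exact: subalgebra1|rewrite mul1r].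
have [b Ob eq_t] : exists2 b, O b & t = b * t'.
  apply/(nonunitsE hO t'_gen)/(nonunitsE hO t_gen).
  by exists 1; [exact: subalgebra1|rewrite mul1r].
have ab1 : b * a = 1.
  by apply: (mulIf t0); rewrite -mulrA -eq_t' -eq_t mul1r.
have ua : units O a.
  have a0 : a != 0.
    by apply/eqP => a0; move/eqP: ab1; rewrite a0 mulr0 eq_sym oner_eq0.
  by split=> //; rewrite -(mulfK a0 b) ab1 mul1r in Ob.
have -> : x * t ^ c = (u' * a ^ e') * t ^ (e' + c).
  by rewrite eq_x' eq_t' expfzMl expfzDr // !mulrA.
rewrite (mul_unitsE hO) ?(generator_Xz hO t_gen t0) //.
by apply: unitsM => //; apply: unitsXz.
Qed.

End LocalRingTheory.

(** * The Cox ring of a smooth variety is a ring *)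

Section CoxSubalgebra.
Variables (k : fieldType) (X : variety k).

Lemma pts_subalgebra O : pts X O -> subalgebra (emb X) O /\
  forall z, exists a b, [/\ O a, O b, b != 0 & z = a / b].
Proof.
have [[n [A [affA ->]]] _] := variety_axiom X.
move=> [i _ [P primeP ->]]; have [[s eqA] fracA] := affA i.
have hA : subalgebra (emb X) (A i) by rewrite eqA; exact: alg_gen_subalgebra.
split; first exact: localize_subalgebra.
have AO x : A i x -> localize (A i) (A i) P x.
  move=> Ax; exists x, 1; split=> //; first exact: (subalgebra1 hA).
    by case: primeP.
  by rewrite divr1.
move=> z; have [x [y [Ax Ay y0 ->]]] := fracA z.
by exists x, y; split=> //; apply: AO.
Qed.

Hypothesis smX : smooth X.

Lemma prime_divisor_generator P : prime_divisor (X := X) P ->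
  exists t, [/\ nonunits P = ideal_gen P [set t], t != 0 &
    forall x c, x != 0 -> P (x * t ^ c) <-> 0 <= ord P x + c].
Proof.
move=> [XP dim1]; have [hP fracP] := pts_subalgebra XP.
have [t t_gen] := regular_dim1_generator (smX XP) dim1.
have t0 := dim1_nonzero_generator hP dim1 t_gen.
by exists t; split=> // x c x0; exact: (ord_sectionE _ hP).
Qed.

Implicit Types D : divisor X.

Lemma sectionsP D s :
  sections D s <-> forall P t, prime_divisor (X := X) P ->
    nonunits P = ideal_gen P [set t] -> t != 0 -> P (s * t ^ coeff P D).
Proof.
split=> [sD P t [XP dim1] t_gen t0|sD].
  have [hP fracP] := pts_subalgebra XP.
  case: sD => [->|sD]; first by rewrite mul0r; exact: (subalgebra0 hP).
  have [->|s0] := eqVneq s 0; first by rewrite mul0r; exact: (subalgebra0 hP).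
  by apply/(ord_sectionE _ hP t_gen dim1 fracP t0 s0)/sD.
have [->|s0] := eqVneq s 0; [by left|right] => P hP.
have [t [t_gen t0 ordE]] := prime_divisor_generator hP.
by apply/ordE => //; apply: sD.
Qed.

Lemma sectionsD D s s' : sections D s -> sections D s' -> sections D (s + s').
Proof.
move=> /sectionsP Ds /sectionsP Ds'.
apply/sectionsP => // P t hP t_gen t0; rewrite mulrDl.
have [[_ PD _] _] := pts_subalgebra hP.1.
by apply: PD; [apply: Ds|apply: Ds'].
Qed.

Lemma sectionsM D D' s s' :
  sections D s -> sections D' s' -> sections (D + D') (s * s').
Proof.
move=> /sectionsP Ds /sectionsP Ds'.
apply/sectionsP => // P t hP t_gen t0; rewrite coeffD expfzDr // mulrACA.
have [[_ _ PM] _] := pts_subalgebra hP.1.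
by apply: PM; [apply: Ds|apply: Ds'].
Qed.

Lemma sections_const a : sections (0 : divisor X) (emb X a).
Proof.
apply/sectionsP => // P t hP _ _; rewrite coeff0 expr0z mulr1.
by have [[Pc _ _] _] := pts_subalgebra hP.1; exact: Pc.
Qed.

Lemma cox_subalgebra K : represents_class_group K ->
  subalgebra (cox_const X) (cox K).
Proof.
move=> [_ K0 KB _].
have KD D D' : K D -> K D' -> K (D + D').
  move=> KD KD'; rewrite -[D']opprK; apply: (KB) => //.
  by rewrite -sub0r; apply: KB.
split=> [a D|x y xK yK D|x y xK yK D].
- rewrite coeffU; have [<-|_] := eqVneq (0 : divisor X) D; last first.
    by rewrite mulr0 eqxx.
  by rewrite mulr1 => _; split; [|exact: sections_const].
- rewrite coeffD => xyD.
  have sec z : cox K z -> sections D (coeff D z).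
    move=> zK; have [->|/zK[]//] := eqVneq (coeff D z) 0; by left.
  split; last by apply: sectionsD; apply: sec.
  have [x0|/xK[]//] := eqVneq (coeff D x) 0.
  by move: xyD; rewrite x0 add0r => /yK[].
- rewrite ga_coeffM => xyD; split.
    apply: contrapT => nKD; case/eqP: xyD; rewrite big_seq big1 // => d dx.
    rewrite big_seq big1 // => e ey.
    have [eD|_] := eqVneq (d + e) D; last by rewrite mulr0.
    case: nKD; rewrite -eD; move: dx ey; rewrite !mem_dom.
    by move=> /xK[Kd _] /yK[Ke _]; exact: KD.
  have sec0 : sections D 0 by left.
  rewrite big_seq; elim/big_rec: _ => // d s dx Ds; apply: sectionsD => //.
  rewrite big_seq; elim/big_rec: _ => // e s' ey Ds'; apply: sectionsD => //.
  have [<-|_] := eqVneq (d + e) D; last by rewrite mulr0.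
  rewrite mulr1; move: dx ey; rewrite !mem_dom => /xK[_ dx] /yK[_ ey].
  exact: sectionsM.
Qed.

End CoxSubalgebra.

(** * Extension and contraction of an ideal of C[T] *)

Lemma big_fibers (I J : eqType) (V : nmodType) (s : seq I) (g : I -> J)
    (G : I -> V) :
  \sum_(i <- s) G i =
  \sum_(j <- undup (map g s)) \sum_(i <- s | g i == j) G i.
Proof.
rewrite (exchange_big_dep xpredT) //= [LHS]big_seq [RHS]big_seq.
apply: eq_bigr => i si; rewrite big_mkcond (bigD1_seq (g i)) ?undup_uniq //=.
  rewrite eqxx big1 ?addr0 // => j /negPf neq_ji.
  by rewrite eq_sym neq_ji.
by rewrite mem_undup map_f.
Qed.

Lemma mpoly_ring_ind (R : nzRingType) (n : nat) (P : {mpoly R[n]} -> Prop) :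
  (forall c, P c%:MP) -> (forall i, P 'X_i) ->
  (forall p q, P p -> P q -> P (p + q)) ->
  (forall p q, P p -> P q -> P (p * q)) -> forall p, P p.
Proof.
move=> PC PX PD PM p; rewrite [p]mpolyE.
elim/big_ind: _ => [||M _]; [by rewrite -mpolyC0|exact: PD|].
rewrite -mul_mpolyC mpolyXE_id; apply: (PM) => //.
elim/big_ind: _ => [||i _]; [by rewrite -mpolyC1|exact: PM|].
elim: (M i) => [|l IHl]; first by rewrite expr0 -mpolyC1.
by rewrite exprS; apply: (PM).
Qed.

Lemma kernel_prime (A B : comNzRingType) (f : {rmorphism A -> B}) :
  GRing.integral_domain_axiom B -> prime_in setT [set x | f x = 0].
Proof.
move=> intB; split=> [|/eqP|x y _ _ /=].
- split=> [//||x y /= fx fy|a x _ /= fx]; first exact: rmorph0.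
    by rewrite rmorphD fx fy addr0.
  by rewrite rmorphM fx mulr0.
- by rewrite rmorph1 oner_eq0.
- by rewrite rmorphM => /intB/orP[]/eqP; [left|right].
Qed.

Section Contraction.
Variables (k : fieldType) (m n : nat) (mu : 'I_m -> 'I_n -> nat).
Implicit Types (e : 'I_n -> nat) (p : {mpoly k[m + n]}).

Lemma monomS0 : monomS k m (fun _ : 'I_n => 0%N) = 1.
Proof. by rewrite /monomS big1. Qed.

HB.instance Definition _ := GRing.RMorphism.copy (@beta k m n mu)
  (comp_mpoly [tuple 'X_(lshift n i) * monomS k m (mu i) | i < m]).

Lemma betaXU i : beta mu 'X_i = 'X_(lshift n i) * monomS k m (mu i).
Proof. by rewrite /beta comp_mpolyXU -tnth_nth tnth_mktuple. Qed.

Lemma monomSD e e' :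
  monomS k m (fun j => e j + e' j)%N = monomS k m e * monomS k m e'.
Proof. by rewrite -big_split; apply: eq_bigr => j _; rewrite exprD. Qed.

Lemma monomS_neq0 e : monomS k m e != 0.
Proof.
apply/prodf_neq0 => j _; rewrite expf_neq0 //.
by rewrite -(msupp_eq0) msuppX.
Qed.

Lemma monomS_lreg (B : comNzRingType)
    (f : {rmorphism {mpoly k[m + n]} -> B}) e :
  (forall j, GRing.lreg (f 'X_(rshift m j))) -> GRing.lreg (f (monomS k m e)).
Proof.
move=> regS; rewrite rmorph_prod; elim/big_ind: _ => [|x y|j _].
- exact: lreg1.
- exact: lregM.
- by rewrite rmorphXn; exact: lregX.
Qed.

(** The fractions with numerator in the kernel form an ideal of the Laurent
    polynomials which contains alpha(J); regularity of the f(S_j) removes the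
    denominators. *)
Lemma ext_contr_sub_kernel (B : comNzRingType)
    (f : {rmorphism {mpoly k[m + n]} -> B}) (J : set {mpoly k[m]}) :
  (forall j, GRing.lreg (f 'X_(rshift m j))) ->
  (forall q, J q -> f (beta mu q) = 0) ->
  ext_contr mu J `<=` [set p | f p = 0].
Proof.
move=> regS fJ p Jp.
have mS0 e : tofrac (monomS k m e) != 0 by rewrite tofrac_eq0 monomS_neq0.
pose I := [set z | exists p' e, f p' = 0 /\
  z = tofrac p' / tofrac (monomS k m e)].
have [] : I (tofrac p); last first.
  move=> p' [e [fp' /(congr1 ( *%R^~ (tofrac (monomS k m e))))]] /eqP.
  rewrite /= divfK // -tofracM tofrac_eq => /eqP eq_p'.
  apply/eqP; rewrite -(mulrI_eq0 _ (monomS_lreg (e := e) regS)) -rmorphM mulrC.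
  by rewrite eq_p' fp'.
apply: Jp; split=> [|_ [q Jq <-]]; last first.
  exists (beta mu q), (fun=> 0%N).
  by rewrite fJ // monomS0 tofrac1 divr1.
split=> [_ [p' [e [_ ->]]]||_ _ [p1 [e1 [fp1 ->]]] [p2 [e2 [fp2 ->]]]|
         _ _ [r [e1 ->]] [p2 [e2 [fp2 ->]]]].
- by exists p', e.
- by exists 0, (fun=> 0%N); rewrite rmorph0 tofrac0 mul0r.
- exists (p1 * monomS k m e2 + p2 * monomS k m e1), (fun j => e1 j + e2 j)%N.
  rewrite rmorphD !rmorphM fp1 fp2 !mul0r addr0; split=> //.
  by rewrite monomSD tofracD !tofracM addf_div.
- exists (r * p2), (fun j => e1 j + e2 j)%N.
  by rewrite rmorphM fp2 mulr0 monomSD !tofracM mulf_div.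
Qed.

Definition degS e : {freeg 'I_n / int} := \sum_(j < n) << j >> *+ e j.

Lemma coeff_degS e j : coeff j (degS e) = e j.
Proof.
rewrite raddf_sum (bigD1 j) //= coeffMn coeffU eqxx big1 ?addr0.
  by rewrite mulr1 natz.
by move=> i /negPf neq_ij; rewrite coeffMn coeffU neq_ij mulr0 mul0rn.
Qed.

Section Kernel.
Variables (A : comNzRingType) (f : {rmorphism k -> A}) (s : 'I_m -> A).
Local Notation B := (group_alg A {freeg 'I_n / int}).

(** T_i |-> s_i m_i(S)^{-1} and S_j |-> S_j, with the Laurent monomials in S
    as group elements of Z^n. *)
Definition twisted_gen (i : 'I_(m + n)) : B :=
  match split i with
  | inl i => << s i *g - degS (mu i) >>
  | inr j => << 1 *g << j >> >>
  end.

Definition twisted_eval : {mpoly k[m + n]} -> B :=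
  mmap (ga_const {freeg 'I_n / int} f) twisted_gen.

HB.instance Definition _ := GRing.RMorphism.copy twisted_eval
  (mmap (ga_const {freeg 'I_n / int} f) twisted_gen).

Definition mnmT (M : 'X_{1..m + n}) : 'X_{1..m} :=
  [multinom M (lshift n i) | i < m].

(** The K_S-degree, in which T_i has degree - deg m_i(S). *)
Definition wt (M : 'X_{1..m + n}) : {freeg 'I_n / int} :=
  degS (fun j => M (rshift m j)) -
  \sum_(i < m) degS (mu i) *+ M (lshift n i).

(** The K_S-homogeneous component of p of degree w, with the S variables set to
    1, which loses nothing: w and the exponents of the T variables determine
    those of the S variables. *)
Definition wtpart p (w : {freeg 'I_n / int}) : {mpoly k[m]} :=
  \sum_(M <- msupp p | wt M == w) p@_M *: 'X_[mnmT M].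

Lemma twisted_gen_lshift i :
  twisted_gen (lshift n i) = << s i *g - degS (mu i) >>.
Proof. by rewrite /twisted_gen (unsplitK (inl i)). Qed.

Lemma twisted_gen_rshift j : twisted_gen (rshift m j) = << 1 *g << j >> >>.
Proof. by rewrite /twisted_gen (unsplitK (inr j)). Qed.

Lemma twisted_evalX M :
  twisted_eval 'X_[M] = << mmap f s 'X_[mnmT M] *g wt M >>.
Proof.
rewrite /twisted_eval !mmapX /mmap1 big_split_ord /=.
rewrite (eq_bigr (fun i => (<< s i *g - degS (mu i) >> : B) ^+ mnmT M i)).
  rewrite (eq_bigr (fun j => (<< 1 *g << j >> >> : B) ^+ M (rshift m j))).
    rewrite !ga_prodU ga_mulUU [X in _ * X]big1 ?mulr1.
      congr << _ *g _ >>; rewrite /wt addrC; congr (_ + _).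
      rewrite -sumrN; apply: eq_bigr => i _; by rewrite mnmE mulNrn.
    by move=> j _; rewrite expr1n.
  by move=> j _; rewrite twisted_gen_rshift.
by move=> i _; rewrite twisted_gen_lshift mnmE.
Qed.

Lemma coeff_twisted_eval p w :
  coeff w (twisted_eval p) = mmap f s (wtpart p w).
Proof.
rewrite {1}[p]mpolyE rmorph_sum raddf_sum /= /wtpart raddf_sum /=.
rewrite [RHS]big_mkcond; apply: eq_bigr => M _.
rewrite /twisted_eval mmapZ -/twisted_eval twisted_evalX ga_mulUU add0r coeffU.
by rewrite mmapZ; case: eqVneq => _; rewrite (mulr1, mulr0).
Qed.

Lemma twisted_eval_lshift i :
  twisted_eval 'X_(lshift n i) = << s i *g - degS (mu i) >>.
Proof. by rewrite /twisted_eval mmapX mmap1U twisted_gen_lshift. Qed.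

Lemma twisted_eval_rshift j :
  twisted_eval 'X_(rshift m j) = << 1 *g << j >> >>.
Proof. by rewrite /twisted_eval mmapX mmap1U twisted_gen_rshift. Qed.

Lemma twisted_eval_monomS e : twisted_eval (monomS k m e) = << 1 *g degS e >>.
Proof.
rewrite rmorph_prod /=.
rewrite (eq_bigr (fun j => (<< 1 *g << j >> >> : B) ^+ e j)).
  by rewrite ga_prodU big1 // => j _; rewrite expr1n.
by move=> j _; rewrite rmorphXn /= twisted_eval_rshift.
Qed.

Lemma twisted_eval_beta q : twisted_eval (beta mu q) = << mmap f s q *g 0 >>.
Proof.
elim/mpoly_ring_ind: q => [c|i|p q IHp IHq|p q IHp IHq].
- by rewrite /beta comp_mpolyC /twisted_eval !mmapC.
- rewrite betaXU rmorphM /= twisted_eval_lshift twisted_eval_monomS ga_mulUU.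
  by rewrite mulr1 addNr mmapX mmap1U.
- by rewrite !rmorphD /= IHp IHq freegUD.
- by rewrite !rmorphM /= IHp IHq ga_mulUU addr0.
Qed.

(** T^u S^v = beta(T^u) S^{v - mu u}; the factor S^N makes the exponent
    nonnegative, so that the absolute value is only a conversion to naturals.
    This exponent depends on M through its weight alone, so that monomials of
    equal weight can be collected. *)
Lemma monomS_shift (N : 'I_n -> nat) (M : 'X_{1..m + n}) :
  (forall j, \sum_(i < m) mu i j * M (lshift n i) <= N j)%N ->
  monomS k m N * 'X_[M] =
  monomS k m (fun j => absz ((N j)%:Z + coeff j (wt M))) *
    beta mu 'X_[mnmT M].
Proof.
move=> leN; rewrite /beta comp_mpolyX mpolyXE_id big_split_ord /=.
rewrite [in RHS](eq_bigr (fun i => 'X_(lshift n i) ^+ M (lshift n i) *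
    \prod_(j < n) 'X_(rshift m j) ^+ (mu i j * M (lshift n i)))); last first.
  move=> i _; rewrite tnth_mktuple mnmE exprMn /monomS -prodrXl.
  by congr (_ * _); apply: eq_bigr => j _; rewrite exprM.
rewrite [in RHS]big_split /= mulrCA [RHS]mulrCA; congr (_ * _).
rewrite exchange_big -!big_split; apply: eq_bigr => j _ /=.
rewrite prodrXr -!exprD; congr (_ ^+ _).
rewrite /wt coeffB coeff_degS raddf_sum /=.
rewrite (eq_bigr (fun i => (mu i j * M (lshift n i))%N%:Z)); last first.
  by move=> i _; rewrite coeffMn coeff_degS -mulr_natr natz -PoszM.
have leNM := leq_trans (leN j) (leq_addr (M (rshift m j)) (N j)).
by rewrite -(big_morph Posz PoszD erefl) addrA -PoszD subzn // absz_nat subnK.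
Qed.

(** The coefficient at w of the image of p is the value at the s_i of the
    component of weight w, so each of these components lies in the kernel J.
    After clearing denominators p is the sum of their images under beta,
    multiplied by monomials in S. *)
Lemma kernel_sub_ext_contr p :
  twisted_eval p = 0 -> ext_contr mu [set q | mmap f s q = 0] p.
Proof.
move=> fp0 I [[_ I0 ID IM] IJ].
(* For S^N to clear the denominators of all monomials of p at once. *)
pose N j := (\sum_(M <- msupp p) \sum_(i < m) mu i j * M (lshift n i))%N.
have NE M : M \in msupp p ->
  forall j, (\sum_(i < m) mu i j * M (lshift n i) <= N j)%N.
  by move=> Mp j; rewrite /N (big_rem M) //= leq_addr.
have Np : monomS k m N * p =
  \sum_(w <- undup (map wt (msupp p)))
    monomS k m (fun j => absz ((N j)%:Z + coeff j w)) * beta mu (wtpart p w).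
  rewrite {1}[p]mpolyE mulr_sumr (big_fibers _ wt); apply: eq_bigr => w _.
  rewrite rmorph_sum mulr_sumr /= big_seq_cond [RHS]big_seq_cond.
  apply: eq_bigr => M /andP[Mp /eqP <-].
  by rewrite [X in _ = _ * X]comp_mpolyZ -!scalerAr -monomS_shift //; exact: NE.
have N0 : tofrac (monomS k m N) != 0 by rewrite tofrac_eq0 monomS_neq0.
have -> : tofrac p = tofrac (monomS k m N * p) / tofrac (monomS k m N).
  by rewrite tofracM mulrC mulKf.
rewrite Np (raddf_sum (@tofrac _)) mulr_suml; elim/big_ind: _ => // w _.
rewrite /= tofracM mulrAC; apply: IM.
  by exists (monomS k m (fun j => absz ((N j)%:Z + coeff j w))), N.
apply: IJ; exists (wtpart p w) => //=.
by rewrite -coeff_twisted_eval fp0 coeff0.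
Qed.

Lemma ext_contr_eq_kernel :
  ext_contr mu [set q | mmap f s q = 0] = [set p | twisted_eval p = 0].
Proof.
apply/seteqP; split=> [|p]; last exact: kernel_sub_ext_contr.
apply: (ext_contr_sub_kernel (f := twisted_eval)) => [j|q /= fq0].
  rewrite /= twisted_eval_rshift.
  by apply: (ga_unit_lreg (b := 1)); rewrite mulr1.
by rewrite twisted_eval_beta fq0 freegU0.
Qed.

Lemma ext_contr_prime : GRing.integral_domain_axiom A ->
  prime_in setT (ext_contr mu [set q | mmap f s q = 0]).
Proof.
move=> intA; rewrite ext_contr_eq_kernel; apply: kernel_prime.
exact: ga_integral.
Qed.

End Kernel.
End Contraction.

(** * Comparison with the ideal of the Cox ring *)

(** Otherwise I extends a longest chain of primes over J at its lower end. *)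
Lemma prime_eq_of_same_dim (R : comNzRingType) (I J : set R) :
  prime_in setT I -> I `<=` J -> same_dim I J -> I = J.
Proof.
move=> primeI IJ [d [[_ maxI] [[P [primeP ltP]] _]]].
apply: contrapT => neqIJ.
suff /maxI : prime_chain setT I d.+1 (fun i => if i is j.+1 then P j else I).
  by rewrite ltnn.
split=> [[|i] lt_i|[|i] lt_i]; first by split.
- have [primePi JPi] := primeP i lt_i.
  by split=> //; apply: subset_trans JPi.
- have [_ JP0] := primeP 0%N isT; split; first exact: subset_trans JP0.
  move=> P0I; apply: neqIJ; apply/seteqP; split=> //.
  exact: subset_trans P0I.
- exact: ltP.
Qed.

Section CoxRings.
Variables (k : fieldType) (X Y : variety k).

(** The pull-back is additive and multiplicative only on R(Y), so the induction
    on q must also carry that phi(q) lies in R(Y). *)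
Lemma cox_eval_beta (KX : set (divisor X)) (KY : set (divisor Y))
    (fs : {rmorphism ffield Y -> ffield X})
    (m n : nat) (x : 'I_(m + n) -> cox_ambient X) (mu : 'I_m -> 'I_n -> nat)
    (fstar : cox_ambient Y -> cox_ambient X) (s : 'I_m -> cox_ambient Y) :
  smooth Y -> represents_class_group KY -> cox_pullback fs KY KX fstar ->
  (forall i, cox KY (s i)) ->
  (forall i, cox_eval x (beta mu 'X_i) = fstar (s i)) ->
  forall q, cox_eval x (beta mu q) = fstar (cox_eval s q).
Proof.
move=> smY hKY [_ fD fM fc _] hs hfs q.
have [coxC coxD coxM] := cox_subalgebra smY hKY.
have evalD (Z : variety k) l (z : 'I_l -> cox_ambient Z) :
    {morph cox_eval z : p q / p + q}.
  exact: (rmorphD (mmap (ga_const (divisor Z) (emb Z)) z)).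
have evalM (Z : variety k) l (z : 'I_l -> cox_ambient Z) :
    {morph cox_eval z : p q / p * q}.
  exact: (rmorphM (mmap (ga_const (divisor Z) (emb Z)) z)).
have evalC (Z : variety k) l (z : 'I_l -> cox_ambient Z) c :
    cox_eval z c%:MP = cox_const Z c.
  exact: (mmapC _ (ga_const (divisor Z) (emb Z))).
suff [] : cox KY (cox_eval s q) /\
    cox_eval x (beta mu q) = fstar (cox_eval s q) by [].
elim/mpoly_ring_ind: q => [c|i|p q [Kp IHp] [Kq IHq]|p q [Kp IHp] [Kq IHq]].
- by rewrite /beta comp_mpolyC !evalC fc.
- suff -> : cox_eval s 'X_i = s i by [].
  exact: (etrans (mmapX _ (ga_const (divisor Y) (emb Y)) _) (mmap1U _ _)).
- by rewrite rmorphD !evalD IHp IHq fD //; split=> //; apply: coxD.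
- by rewrite rmorphM !evalM IHp IHq fM //; split=> //; apply: coxM.
Qed.

End CoxRings.

Theorem corollary4p2 (R : realType)
    (* f : X -> Y, with comorphism fs *)
    (X Y : variety R[i]) (fs : {rmorphism ffield Y -> ffield X})
    (smX : smooth X) (mdsX : mori_dream_space X)
    (smY : smooth Y) (mdsY : mori_dream_space Y)
    (blow_up : is_blow_up fs)
    (KX : set (divisor X)) (hKX : represents_class_group KX)
    (KY : set (divisor Y)) (hKY : represents_class_group KY)
    (* the generators T_1, ..., T_m, S_1, ..., S_n and their degrees *)
    (m n : nat) (x : 'I_(m + n) -> cox_ambient X)
    (d : 'I_(m + n) -> divisor X)
    (hx : minimal_generators KX x d)
    (E : 'I_n -> set (ffield X)) (E_inj : injective E)
    (hE : range E = [set P | exceptional fs P])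
    (hS : forall j, defines_divisor (d (rshift m j)) (x (rshift m j)) (E j))
    (* the monomials m_i(S) *)
    (mu : 'I_m -> 'I_n -> nat)
    (hmu : forall i, in_pullback_class fs
       (d (lshift n i) + \sum_(j < n) d (rshift m j) *+ mu i j))
    (* f^* : R(Y) -> R(X) and the s_i *)
    (fstar : cox_ambient Y -> cox_ambient X)
    (hfstar : cox_pullback fs KY KX fstar)
    (s : 'I_m -> cox_ambient Y) (hs : forall i, cox KY (s i))
    (hfs : forall i, cox_eval x (beta mu 'X_i) = fstar (s i)) :
  let IX := cox_kernel x in
  let J := cox_kernel s in
  let J' := ext_contr mu J in
  J' `<=` IX /\ (same_dim J' IX -> J' = IX).
Proof.
move=> IX J J'.
have eval_beta := cox_eval_beta smY hKY hfstar hs hfs.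
have J'IX : J' `<=` IX.
  apply: (ext_contr_sub_kernel (f := mmap (ga_const (divisor X) (emb X)) x)).
    move=> j; rewrite /= mmapX mmap1U.
    have [u [u0 -> _]] := hS j.
    by apply: (ga_unit_lreg (b := u^-1)); rewrite mulVf.
  move=> q Jq; apply: etrans (eval_beta q) _; rewrite Jq.
  have [_ fD _ _ _] := hfstar; have [coxC _ _] := cox_subalgebra smY hKY.
  have cox0 : cox KY 0 by move=> D; rewrite coeff0 eqxx.
  by apply: (addrI (fstar 0)); rewrite -fD // !addr0.
split=> //; apply: prime_eq_of_same_dim => //.
apply: (ext_contr_prime mu (ga_const (divisor Y) (emb Y)) s).
apply: ga_integral => a b /eqP.
by rewrite mulf_eq0.
Qed.
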